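(* For every tree $T$ on $n$ vertices, $f(T) \ge \frac{n}{4} + 1$. Moreover, this bound is tight up to an additive constant: there exist a constant $C$ and infinitely many trees $T$ with $f(T) \le \frac{|V(T)|}{4} + C$.
   Context: All graphs are finite, simple, connected and have at least 4 vertices. A path in a graph $G$ is a sequence of distinct vertices $v_0,\dots,v_r$ ($r \ge 0$) with $v_{i-1}v_i \in E(G)$ for all $i$; a path with $r=0$ (a single vertex) is allowed. A vertex-separating path system of $G$ is a collection of distinct paths in $G$ such that for every pair of distinct vertices $u,v \in V(G)$ some path in the collection contains exactly one of $u$ and $v$. $f(G)$ denotes the minimum size of a vertex-separating path system of $G$. *)

(* Defs.v *)
From mathcomp Require Import all_boot.
Set Implicit Arguments.
Unset Strict Implicit.
Unset Printing Implicit Defensive.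

Record sgraph := SGraph {
  vertex :> finType;
  adj : rel vertex;
  adj_sym : symmetric adj;
  adj_irrefl : irreflexive adj }.

Definition isomorphic (G H : sgraph) : Prop :=
  exists2 h : G -> H, bijective h & {mono h : x y / adj x y}.

Definition connected (G : sgraph) : Prop := forall x y : G, connect (@adj G) x y.

(* The length condition is needed: an edge xy traversed back and forth is
   already a duplicate-free [cycle] [:: x; y] in the sense of the library. *)
Definition acyclic (G : sgraph) : Prop :=
  forall c : seq G, 2 < size c -> uniq c -> ~~ cycle (@adj G) c.

Definition is_tree (G : sgraph) : Prop := connected G /\ acyclic G.

Definition is_path (G : sgraph) (s : seq G) : bool :=
  if s is x :: p then path (@adj G) x p && uniq s else false.

(* Since a path has no repeated vertex, its length is at most #|G|, so the
   finite type of sequences of length at most #|G| contains all paths. *)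
Definition path_system (G : sgraph) (S : {set #|G|.-bseq G}) : bool :=
  [forall P in S, is_path P].

Definition vertex_separating (G : sgraph) (S : {set #|G|.-bseq G}) : bool :=
  [forall u : G, forall v : G,
     (u != v) ==> [exists P in S, (u \in P) (+) (v \in P)]].

Definition vsep_path_system (G : sgraph) (S : {set #|G|.-bseq G}) : bool :=
  path_system S && vertex_separating S.

Definition all_paths (G : sgraph) : {set #|G|.-bseq G} :=
  [set P : #|G|.-bseq G | is_path P].

(* The set of all paths only serves as a starting value for the minimum; it is
   a vertex-separating path system by [all_paths_vsep] below. *)
Definition fsep (G : sgraph) : nat :=
  #|[arg min_(S < all_paths G | vsep_path_system S) #|S|]|.

Lemma path_size (G : sgraph) (s : seq G) : is_path s -> size s <= #|G|.
Proof.
case: s => [|x p] // /andP[_ s_uniq].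
by rewrite -(card_uniqP s_uniq) max_card.
Qed.

Lemma all_paths_vsep (G : sgraph) : vsep_path_system (all_paths G).
Proof.
apply/andP; split; first by apply/forall_inP => P; rewrite inE.
apply/forallP => u; apply/forallP => v; apply/implyP => neq_uv.
have u_path : is_path [:: u] by [].
apply/exists_inP; exists (Bseq (path_size u_path)); first by rewrite inE.
by rewrite !inE eqxx eq_sym (negPf neq_uv).
Qed.

Lemma fsep_attained (G : sgraph) :
  exists2 S : {set #|G|.-bseq G}, vsep_path_system S & fsep G = #|S|.
Proof.
rewrite /fsep; case: arg_minnP => [|S S_sep _]; first exact: all_paths_vsep.
by exists S.
Qed.

Lemma fsep_min (G : sgraph) (S : {set #|G|.-bseq G}) :
  vsep_path_system S -> fsep G <= #|S|.
Proof.
rewrite /fsep => S_sep; case: arg_minnP => [|S0 _ min_S0].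
  exact: all_paths_vsep.
exact: min_S0.
Qed.

(* Main.v *)
(** Fix a system of k paths in a tree and let the signature of a vertex be the
    set of paths through it.  In a separating system at most one signature is
    empty and at most k are singletons, so it suffices that at most 3k - 5
    signatures have two elements or more.  Removing an edge cu leaves two
    branches; let M be the set of paths through cu.  By induction on the branch
    at c, if E >= 2 path ends lie in it, at most (3E - 6)/2 signatures of size
    at least 2 other than M occur there.  The two branches of an edge share the
    2k path ends, so when both contain at least two, adding the bounds and 1
    for M gives 3k - 5.  If there is no such edge, then some vertex has only
    branches with at most one end around it and is alone in having a signature
    of size at least 2.

    For the upper bound, take a comb with 4 vertices per column in which the
    i-th path starts at the leaf of column i, runs along the spine and ends at
    the tooth of column i + 2; a bounded number of one-vertex paths separates
    the two columns at either end. *)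
Require Import Defs.
From mathcomp Require Import all_boot all_order all_algebra.
From mathcomp Require Import zify lra.
Import Order.TTheory GRing.Theory Num.Theory.

Set Implicit Arguments.
Unset Strict Implicit.
Unset Printing Implicit Defensive.

(** * Branches of a tree *)

Lemma connect_invariant (V : finType) (e : rel V) (Q : V -> Prop) (x z : V) :
  Q x -> (forall a b, Q a -> e a b -> Q b) -> connect e x z -> Q z.
Proof.
move=> Qx step /connectP[p + ->].
elim: p x Qx => //= y p IH x Qx /andP[exy]; exact/IH/(step x).
Qed.

(** The bridge [cu] seen from the side of [c]. Allowing an arbitrary set [C] makes the notion pass
    to complements. *)
Definition branch (G : sgraph) (C : {set G}) (c u : G) : Prop :=
  [/\ c \in C, u \notin C &
      forall x y, x \in C -> y \notin C -> adj x y -> x = c /\ y = u].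

(* Deleting only the arc from [c] to [u] is enough: a walk from [c] that does
   not repeat vertices never uses the arc back. *)
Definition side (G : sgraph) (c u : G) : {set G} :=
  [set x | connect (fun a b => adj a b && ((a, b) != (c, u))) c x].

Lemma branchC (G : sgraph) (C : {set G}) (c u : G) :
  branch C c u -> branch (~: C) u c.
Proof.
move=> [cC uC cross]; split; rewrite ?inE ?negbK // => x y.
by rewrite !inE negbK adj_sym => xC yC /(cross y x yC xC)[-> ->].
Qed.

(** Any other arc leaving the side would extend the walk to its tail. If [u] were reachable, a
    simple walk to it, closed by the edge [uc], would be a cycle. *)
Lemma side_branch (G : sgraph) (c u : G) :
  acyclic G -> adj c u -> branch (side c u) c u.
Proof.
move=> acG cu; split; rewrite ?inE ?connect0 //; last first.
  move=> x y; rewrite !inE => cx ncy xy.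
  case: (eqVneq (x, y) (c, u)) => [[-> ->] // | ne].
  by case/negP: ncy; apply: connect_trans cx (connect1 _); rewrite xy ne.
apply/negP => /connectP[p /shortenP[q path_q uniq_q _] last_q].
have path_adj : path (@adj G) c q.
  by apply: sub_path path_q => a b /andP[].
have/negP[] : ~~ cycle (@adj G) (c :: q).
  (* An empty [q] would make [cu] a loop and a one-vertex [q] would use the deleted arc, so the
     cycle has more than two vertices. *)
  apply: (acG _ _ uniq_q); case: q path_q last_q {path_adj uniq_q} => [|y [|z q]] //=.
    by move=> _ uc; rewrite uc adj_irrefl in cu.
  by move=> + uy; rewrite -uy eqxx andbF.
by rewrite /= rcons_path path_adj -last_q adj_sym.
Qed.

Lemma side_ind (G : sgraph) (c u : G) (Q : G -> Prop) :
    Q c -> (forall x y, x \in side c u -> Q x -> adj x y -> y \in side c u -> Q y) ->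
  forall z, z \in side c u -> Q z.
Proof.
move=> Qc step z; rewrite inE => cz.
suff [] : z \in side c u /\ Q z by [].
move: cz; apply: (connect_invariant (Q := fun z => z \in side c u /\ Q z)) => [|a b [aC Qa] ab].
  by rewrite inE connect0.
have bC : b \in side c u.
  move: aC; rewrite !inE => ca.
  by apply: connect_trans ca _; exact: connect1.
by split=> //; apply: (step a) => //; case/andP: ab.
Qed.

(** A walk from [d] could leave [side c u] only at [c], which is not in [side d c]. *)
Lemma sub_side (G : sgraph) (c d u : G) :
    acyclic G -> adj c u -> adj d c -> d != u ->
  side d c \subset side c u.
Proof.
move=> acG cu dc du.
have [cC _ crossC] := side_branch acG cu; have [_ cD _] := side_branch acG dc.
apply/subsetP; apply: side_ind => [|x y xD xC xy _]; apply: contraT => yC.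
  by have [_ /eqP] := crossC _ _ cC yC (etrans (adj_sym _ _) dc); rewrite (negPf du).
by have [xc _] := crossC _ _ xC yC xy; rewrite xc (negPf cD) in xD.
Qed.

(** A walk from [d] could enter [side d' c] only from [c], which is not in [side d c]. *)
Lemma sides_disjoint (G : sgraph) (c d d' : G) :
    acyclic G -> adj d c -> adj d' c -> d != d' ->
  forall z, z \in side d c -> z \notin side d' c.
Proof.
move=> acG dc d'c dd'.
have [_ cD' crossD'] := side_branch acG d'c; have [_ cD _] := side_branch acG dc.
apply: side_ind => [|x y xD xD' xy _]; apply/negP => yD'.
  by have [/eqP] := crossD' _ _ yD' cD' dc; rewrite (negPf dd').
rewrite adj_sym in xy.
by have [_ xc] := crossD' _ _ yD' xD' xy; rewrite xc (negPf cD) in xD.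
Qed.

Lemma side_cover (G : sgraph) (c x : G) :
  is_tree G -> x != c -> exists2 d, adj d c & x \in side d c.
Proof.
move=> [coG acG] xc.
suff [/eqP | //] : x = c \/ exists2 d, adj d c & x \in side d c.
  by rewrite (negPf xc).
pose Q x := x = c \/ exists2 d, adj d c & x \in side d c.
apply: (connect_invariant (Q := Q) _ _ (coG c x)) => [|a b]; first by left.
case: (eqVneq b c) => [|bc]; first by left.
move=> + ab; case=> [ac | [d dc ad]]; right.
  by exists b; rewrite ?inE ?connect0 // adj_sym -ac.
exists d => //; apply: contraT => bd.
have [_ _ cross] := side_branch acG dc.
by have [_ /eqP] := cross _ _ ad bd ab; rewrite (negPf bc).
Qed.

(** The bridge is the only exit from either side and leads into the other, so a walk from [c] never
    leaves their union. *)
Lemma side_compl (G : sgraph) (c u : G) :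
  is_tree G -> adj c u -> side u c = ~: side c u.
Proof.
move=> [coG acG] cu; have uc : adj u c by rewrite adj_sym.
have [cC uC crossC] := side_branch acG cu.
have [uU cU crossU] := side_branch acG uc.
have disj : forall z, z \in side u c -> z \notin side c u.
  apply: side_ind => // x y xU xC xy yU; apply/negP => yC; rewrite adj_sym in xy.
  by have [yc _] := crossC _ _ yC xC xy; rewrite yc (negPf cU) in yU.
apply/setP => z; rewrite [RHS]inE; apply/idP/idP => [/disj // | zC].
suff /orP[] : (z \in side c u) || (z \in side u c) by rewrite ?(negPf zC).
apply: (connect_invariant (Q := fun z => _ || _) _ _ (coG c z)) => [|a b]; first by rewrite cC.
move=> + ab; apply: contraLR; rewrite !negb_or => /andP[bC bU].
apply/andP; split; apply/negP => aX.
  by have [_ bu] := crossC _ _ aX bC ab; rewrite bu uU in bU.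
by have [_ bu] := crossU _ _ aX bU ab; rewrite bu cC in bC.
Qed.

(* A one-vertex path has two ends at its vertex. *)
Definition ends_in (G : sgraph) (s : seq G) (X : {set G}) : nat :=
  if s is x :: p then (x \in X) + (last x p \in X) else 0.

Lemma ends_inT (G : sgraph) (s : seq G) : is_path s -> ends_in s [set: G] = 2.
Proof. by case: s => //= x p _; rewrite !inE. Qed.

Lemma ends_in_setID (G : sgraph) (s : seq G) (X Y : {set G}) :
  Y \subset X -> ends_in s X = ends_in s Y + ends_in s (X :\: Y).
Proof.
move=> /subsetP YX; case: s => //= x p; rewrite !inE.
have := YX (last x p); have := YX x.
by case: (x \in Y) => [/(_ isT)->|_]; case: (last x p \in Y) => [/(_ isT)->|_] //=; lia.
Qed.

Lemma branch_const (G : sgraph) (C : {set G}) (c u y : G) (q : seq G) :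
    branch C c u -> path (@adj G) y q -> u \notin y :: q ->
  {in y :: q, forall x, (x \in C) = (y \in C)}.
Proof.
move=> [_ _ cross]; elim: q y => [|z q IH] y /=.
  by move=> _ _ x; rewrite inE => /eqP ->.
move=> /andP[yz path_q]; rewrite inE negb_or => /andP[uy uq] x.
have yzC : (z \in C) = (y \in C).
  apply/idP/idP => inC; apply: contraT => outC.
    by have [_ /eqP] := cross _ _ inC outC (etrans (adj_sym _ _) yz); rewrite eq_sym (negPf uy).
  by have [_ zu] := cross _ _ inC outC yz; rewrite zu mem_head in uq.
rewrite inE => /predU1P[-> // | xq]; rewrite -yzC; exact: IH.
Qed.

Lemma ends_in_avoid (G : sgraph) (C : {set G}) (c u x : G) (s : seq G) :
    is_path s -> branch C c u -> x \in s -> x \in C -> u \notin s ->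
  ends_in s C = 2.
Proof.
case: s => //= y p /andP[path_p _] brC xs xC us.
have const := branch_const brC path_p us.
by rewrite (const (last y p)) ?mem_last // -(const x) ?xC.
Qed.

(** With both ends outside [C], the path would visit [u] both before and after [x], repeating a
    vertex. *)
Lemma ends_in_gt0 (G : sgraph) (C : {set G}) (c u x : G) (s : seq G) :
  is_path s -> branch C c u -> x \in s -> x \in C -> 0 < ends_in s C.
Proof.
move=> path_s brC xs xC; have [_ uC _] := brC.
have xu : u != x by apply: contraNneq uC => ->.
case: s path_s xs => // y p /andP[path_p uniq_p].
rewrite inE => /predU1P[<- | xp]; first by rewrite /= xC.
rewrite lt0n; apply: contraT; rewrite negbK /= addn_eq0 !eqb0 => /andP[yC lC].
move: path_p uniq_p lC; case/splitPr: xp => p1 p2.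
rewrite -cat_rcons cat_path last_cat last_rcons -cat_cons cat_uniq.
move=> /andP[path1 path2] /and3P[_ /hasPn disj _] lC.
have u2 : u \in p2.
  apply: contraT => up2.
  have := @branch_const _ _ _ _ x p2 brC path2; rewrite inE (negPf xu) => /(_ up2).
  by move=> /(_ _ (mem_last _ _)); rewrite xC (negPf lC).
have u1 : u \in y :: rcons p1 x.
  apply: contraT => up1; have := branch_const brC path1 up1.
  by move=> /(_ x); rewrite xC (negPf yC) inE mem_rcons mem_head orbT => /(_ isT).
by have := disj _ u2; rewrite /= u1.
Qed.

(** * Path ends and signatures *)

Definition num_ends (G : sgraph) (S : {set #|G|.-bseq G}) (X : {set G}) : nat :=
  \sum_(P in S) ends_in P X.

Definition signature (G : sgraph) (S : {set #|G|.-bseq G}) (x : G) :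
    {set #|G|.-bseq G} :=
  [set P in S | x \in (P : seq G)].

(** Counting distinct signatures rather than vertices lets the bounds hold for every path system,
    separating or not. *)
Definition big_signatures (G : sgraph) (S : {set #|G|.-bseq G}) (X : {set G}) :
    {set {set #|G|.-bseq G}} :=
  [set A in signature S @: X | 1 < #|A|].

(** For adjacent [c] and [u] in a tree, these are the paths that use the edge [cu]. *)
Definition crossing (G : sgraph) (S : {set #|G|.-bseq G}) (c u : G) :=
  signature S c :&: signature S u.

Lemma path_system_is_path (G : sgraph) (S : {set #|G|.-bseq G}) x P :
  path_system S -> P \in signature S x -> [/\ P \in S, is_path P & x \in (P : seq G)].
Proof. by move=> /forall_inP pathS; rewrite inE => /andP[PS xP]; split=> //; apply: pathS. Qed.

Lemma num_ends_setID (G : sgraph) (S : {set #|G|.-bseq G}) (X Y : {set G}) :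
  Y \subset X -> num_ends S X = num_ends S Y + num_ends S (X :\: Y).
Proof.
by move=> YX; rewrite -big_split; apply: eq_bigr => P _; apply: ends_in_setID.
Qed.

Lemma num_endsT (G : sgraph) (S : {set #|G|.-bseq G}) :
  path_system S -> num_ends S [set: G] = #|S| * 2.
Proof.
move=> /forall_inP pathS; rewrite -sum_nat_const; apply: eq_bigr => P PS.
exact/ends_inT/pathS.
Qed.

Lemma sum_num_ends_le (G : sgraph) (S : {set #|G|.-bseq G}) (D : {set G})
    (F : G -> {set G}) (X : {set G}) :
    (forall d, d \in D -> F d \subset X) ->
    {in D &, forall d d', d != d' -> forall z, z \in F d -> z \notin F d'} ->
  \sum_(d in D) num_ends S (F d) <= num_ends S X.
Proof.
move=> sub disj; rewrite exchange_big; apply: leq_sum => P _.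
have le1 x : \sum_(d in D) (x \in F d) <= (x \in X).
  case: (pickP [pred d in D | x \in F d]) => [d /= /andP[dD xd] | none]; last first.
    by rewrite big1 // => d dD; have := none d; rewrite /= dD => /= ->.
  rewrite (bigD1 d) //= (subsetP (sub d dD)) // xd big1 // => d' /andP[d'D d'd].
  by rewrite (negPf (disj _ _ dD d'D _ _ xd)) // eq_sym.
case: (P : seq G) => [|x p] /=; first by rewrite big1.
by rewrite big_split leq_add.
Qed.

Lemma card_bigcup_le (I T : finType) (D : {set I}) (F : I -> {set T}) :
  #|\bigcup_(i in D) F i| <= \sum_(i in D) #|F i|.
Proof.
apply: (big_ind2 (fun (A : {set T}) n => #|A| <= n)) => [|A m B n Am Bn|//].
  by rewrite cards0.
by apply: leq_trans (leq_card_setU A B) _; apply: leq_add.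
Qed.

Lemma leq_card_num_ends (G : sgraph) (S A : {set #|G|.-bseq G}) (X : {set G}) :
    A \subset S -> (forall P, P \in A -> 0 < ends_in P X) ->
  #|A| <= num_ends S X.
Proof.
move=> /setIidPr AS pos; rewrite /num_ends (big_setID A) /= AS.
by apply: leq_trans (leq_addr _ _); rewrite -(sum1_card (mem A)); apply: leq_sum.
Qed.

Lemma ltn_card_num_ends (G : sgraph) (S A : {set #|G|.-bseq G}) (X : {set G}) Q :
    A \subset S -> (forall P, P \in A -> 0 < ends_in P X) ->
    Q \in A -> 1 < ends_in Q X ->
  #|A| < num_ends S X.
Proof.
move=> /[dup] /subsetP AS /setIidPr AE pos QA Q2; rewrite /num_ends (bigD1 Q) ?AS //=.
rewrite (cardsD1 Q A) QA -[_ < _]/(1 + #|A :\ Q| < _) -addnS -[(#|_|).+1]add1n addnA.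
apply: leq_add Q2 _; rewrite -(sum1_card (mem (A :\ Q))) big_mkcond [X in _ <= X]big_mkcond /=.
apply: leq_sum => P _; rewrite !inE.
case: eqP => //= _; rewrite ?andbT; case: ifP => // PA.
by rewrite AS // pos.
Qed.

(** Each path through a vertex of [C] has an end in [C]. *)
Lemma signature_small_branch (G : sgraph) (S : {set #|G|.-bseq G}) (C : {set G}) c u :
    path_system S -> branch C c u -> num_ends S C <= 1 ->
  {in C, forall x, #|signature S x| <= 1}.
Proof.
move=> pathS brC small x xC; apply: leq_trans small; apply: leq_card_num_ends.
  by apply/subsetP => P; rewrite inE => /andP[].
by move=> P /(path_system_is_path pathS)[_ pathP xP]; apply: ends_in_gt0 brC xP xC.
Qed.


(** * Counting big signatures inside a branch *)

Lemma crossing_neq (G : sgraph) (S : {set #|G|.-bseq G}) (c u : G) :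
  signature S c != crossing S c u -> exists2 P, P \in signature S c & u \notin (P : seq G).
Proof.
move=> ne; have /subsetPn[P Pc Pu] : ~~ (signature S c \subset signature S u).
  by apply: contra ne => /setIidPl; rewrite /crossing => ->.
by exists P => //; move: Pc Pu; rewrite !inE => /andP[->].
Qed.

(** Every path through [c] has an end in the branch, and one that avoids [u] has both ends there. *)
Lemma num_ends_no_big_child (G : sgraph) (S : {set #|G|.-bseq G}) (c u : G) :
    is_tree G -> path_system S -> adj c u ->
    signature S c != crossing S c u -> 1 < #|signature S c| ->
  2 < num_ends S (side c u).
Proof.
move=> [_ acG] pathS cu /crossing_neq[Q Qc uQ] big.
have brC := side_branch acG cu; have [cC _ _] := brC.
have [_ pathQ cQ] := path_system_is_path pathS Qc.
apply: leq_ltn_trans big _; apply: (ltn_card_num_ends (Q := Q)) => //.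
- by apply/subsetP => P; rewrite inE => /andP[].
- by move=> P /(path_system_is_path pathS)[_ pathP xP]; apply: ends_in_gt0 brC xP cC.
- by rewrite (ends_in_avoid pathQ brC cQ).
Qed.

(** At least one end lies in [side c u], and both do if [u] is avoided; at most one lies in
    [side d c], and none if [d] is avoided. Subtract. *)
Lemma ends_in_between (G : sgraph) (c d u : G) (s : seq G) :
    is_tree G -> adj c u -> adj d c -> d != u -> is_path s -> c \in s ->
  (u \notin s) + (d \notin s) <= ends_in s (side c u :\: side d c).
Proof.
move=> [_ acG] cu dc du path_s cs.
have brC := side_branch acG cu; have [cC _ _] := brC.
have brD := branchC (side_branch acG dc); have [cD _ _] := brD.
have C_gt0 := ends_in_gt0 path_s brC cs cC.
have D_gt0 := ends_in_gt0 path_s brD cs cD.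
have := ends_in_setID s (subsetT (side d c)); rewrite setTD (ends_inT path_s).
have := ends_in_setID s (sub_side acG cu dc du).
case: (boolP (u \in s)) => [_ | /(ends_in_avoid path_s brC cs cC)];
case: (boolP (d \in s)) => [_ | /(ends_in_avoid path_s brD cs cD)] /=; lia.
Qed.

(** When both inequalities hold, either one path avoids [u] and [d] and has two ends in the
    difference, or two distinct paths have at least one each. *)
Lemma num_ends_between (G : sgraph) (S : {set #|G|.-bseq G}) (c d u : G) :
    is_tree G -> path_system S -> adj c u -> adj d c -> d != u ->
  (signature S c != crossing S c u) + (signature S c != crossing S c d)
    <= num_ends S (side c u :\: side d c).
Proof.
move=> treeG pathS cu dc du; set R := _ :\: _.
have pos P : P \in signature S c ->
    (u \notin (P : seq G)) + (d \notin (P : seq G)) <= ends_in P R.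
  by move=> /(path_system_is_path pathS)[_ pathP cP]; apply: ends_in_between.
have sub1 Q : Q \in signature S c -> [set Q] \subset S.
  by rewrite sub1set inE => /andP[].
have one Q : Q \in signature S c -> 0 < ends_in Q R -> 0 < num_ends S R.
  move=> Qc Q0; rewrite -(cards1 Q); apply: leq_card_num_ends; first exact: sub1.
  by move=> P /set1P ->.
case: (boolP (_ == crossing S c u)) => [_ | /crossing_neq[Q Qc uQ]];
case: (boolP (_ == crossing S c d)) => [_ | /crossing_neq[Q' Q'c dQ']] //=.
- by apply: (one _ Q'c); apply: leq_trans (pos _ Q'c); rewrite dQ'; lia.
- by apply: (one _ Qc); apply: leq_trans (pos _ Qc); rewrite uQ; lia.
have Q0 : 0 < ends_in Q R by apply: leq_trans (pos _ Qc); rewrite uQ; lia.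
case: (eqVneq Q Q') => [QQ' | QQ'].
  suff : #|[set Q]| < num_ends S R by rewrite cards1.
  apply: (ltn_card_num_ends (Q := Q)); rewrite ?set11 ?sub1 //.
    by move=> P /set1P ->.
  by apply: leq_trans (pos _ Qc); rewrite uQ QQ' dQ'.
suff : #|[set Q; Q']| <= num_ends S R by rewrite cards2 QQ'.
apply: leq_card_num_ends; first by rewrite subUset !sub1.
move=> P /set2P[] -> //; by apply: leq_trans (pos _ Q'c); rewrite dQ'; lia.
Qed.

(** The recursion for the induction: only child branches with at least two ends can contain big
    signatures, so all others disappear from the count. *)
Lemma big_signatures_side (G : sgraph) (S : {set #|G|.-bseq G}) (c u : G)
    (D := [set d | [&& adj d c, d != u & 1 < num_ends S (side d c)]]) :
    is_tree G -> path_system S -> adj c u ->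
  big_signatures S (side c u) :\ crossing S c u \subset
    (\bigcup_(d in D) (big_signatures S (side d c) :\ crossing S d c)) :|:
    [set A in signature S c |: [set crossing S c d | d in D] |
       (1 < #|A|) && (A != crossing S c u)].
Proof.
move=> treeG pathS cu; have [_ acG] := treeG.
apply/subsetP => A; rewrite !inE => /and3P[AM /imsetP[x xC Ax] bigA].
rewrite AM bigA !andbT.
case: (eqVneq x c) => [xc | xc]; first by rewrite Ax xc eqxx /= orbT.
have [d dc xD] := side_cover treeG xc.
have du : d != u.
  apply: contraTneq xC => du; move: xD; rewrite du side_compl //.
  by rewrite inE.
case: (leqP (num_ends S (side d c)) 1) => [small | bigD].
  have := signature_small_branch pathS (side_branch acG dc) small xD.
  by rewrite -Ax leqNgt bigA.
have dD : d \in D by rewrite inE dc du bigD.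
case: (eqVneq A (crossing S d c)) => [AMd | AMd].
  suff -> : A \in [set crossing S c d | d in D] by rewrite !orbT.
  by apply/imsetP; exists d; rewrite // AMd /crossing setIC.
apply/orP; left; apply/bigcupP; exists d => //.
by rewrite !inE AMd bigA andbT; apply/imsetP; exists x.
Qed.

(** Induction on the size of the branch, by the number of child branches in [D]. The set [L]
    collects the big signatures not covered by the induction hypotheses. *)
Lemma branch_bound (G : sgraph) (S : {set #|G|.-bseq G}) (c u : G) :
    is_tree G -> path_system S -> adj c u -> 1 < num_ends S (side c u) ->
  2 * #|big_signatures S (side c u) :\ crossing S c u| + 6
    <= 3 * num_ends S (side c u).
Proof.
move=> treeG pathS; have [_ acG] := treeG.
have [n] := ubnP #|side c u|; elim: n c u => // n IH c u le_n cu bigC.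
pose D := [set d | [&& adj d c, d != u & 1 < num_ends S (side d c)]].
pose L := [set A in signature S c |: [set crossing S c d | d in D] |
       (1 < #|A|) && (A != crossing S c u)].
have subC d : d \in D -> side d c \subset side c u.
  by rewrite inE => /and3P[dc du _]; apply: sub_side.
have IHD d : d \in D -> 2 * #|big_signatures S (side d c) :\ crossing S d c| + 6
    <= 3 * num_ends S (side d c).
  move=> dD; have := dD; rewrite inE => /and3P[dc du bigd]; apply: IH => //.
  rewrite ltnS in le_n; apply: leq_trans le_n; apply: proper_card.
  rewrite properE subC //; apply/subsetPn; exists c.
    by have [] := side_branch acG cu.
  by have [] := side_branch acG dc.
have := subset_leq_card (big_signatures_side treeG pathS cu); rewrite -/D -/L.
set w := #|_|; set U := \bigcup_(d in D) _ => w_le.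
have {}w_le : w <= #|U| + #|L| by apply: leq_trans w_le (leq_card_setU _ _).
have U_le := card_bigcup_le D (fun d => big_signatures S (side d c) :\ crossing S d c).
rewrite -/U in U_le.
have sumIH : 2 * \sum_(d in D) #|big_signatures S (side d c) :\ crossing S d c| + 6 * #|D|
    <= 3 * \sum_(d in D) num_ends S (side d c).
  rewrite !big_distrr /= mulnC -sum_nat_const -big_split /=; exact: leq_sum.
(* Several children: the hypotheses save [6 * #|D|], which covers the 6 of the goal and the cost
   [2 * (1 + #|D|)] of [L] once [#|D|] is at least 2. *)
case: (ltnP 1 #|D|) => [D2 | D1].
  have sumE : \sum_(d in D) num_ends S (side d c) <= num_ends S (side c u).
    apply: sum_num_ends_le => // d d'; rewrite !inE => /and3P[dc _ _] /and3P[d'c _ _] dd'.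
    exact: sides_disjoint.
  have : #|L| <= 1 + #|D|.
    apply: (@leq_trans #|signature S c |: [set crossing S c d | d in D]|).
      by apply: subset_leq_card; apply/subsetP => A; rewrite inE => /andP[].
    by rewrite cardsU1 leq_add ?leq_b1 ?leq_imset_card.
  lia.
(* No child: [L] is empty, or it is the signature of [c] alone and then at least 3 ends give
   [2 + 6 <= 9]. *)
case: (posnP #|D|) => [/eqP | D_gt0].
  rewrite cards_eq0 => /eqP D0.
  have U0 : #|U| = 0 by rewrite /U D0 big_set0 cards0.
  case: (posnP #|L|) => [L0 | /card_gt0P[A]]; first by lia.
  rewrite !inE D0 imset0 inE orbF => /andP[/eqP -> /andP[big_c ne_c]].
  have := num_ends_no_big_child treeG pathS cu ne_c big_c.
  have : #|L| <= 1.
    apply: (@leq_trans #|[set signature S c]|); last by rewrite cards1.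
    apply: subset_leq_card; apply/subsetP => B.
    by rewrite !inE D0 imset0 inE orbF => /andP[].
  lia.
(* One child: each new signature costs 2 but is matched by an end outside the child branch, worth
   3. *)
have /cards1P[d Dd] : #|D| == 1 by rewrite eqn_leq D1 D_gt0.
have dD : d \in D by rewrite Dd set11.
move: sumIH; rewrite !Dd !big_set1 cards1 => sumIH.
rewrite Dd big_set1 in U_le.
have := dD; rewrite inE => /and3P[dc du _].
have := num_ends_between treeG pathS cu dc du.
have := num_ends_setID S (subC d dD).
have : #|L| <= (signature S c != crossing S c u) + (signature S c != crossing S c d).
  have -> : #|L| = #|[set A in [set signature S c; crossing S c d] |
                       (1 < #|A|) && (A != crossing S c u)]|.
    by rewrite /L Dd imset_set1.
  (* Each coincidence removes a candidate from [L]: [crossing S c u] is excluded, and equal sets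
     count once. *)
  case: (eqVneq (signature S c) (crossing S c u)) => [E1 | _];
  case: (eqVneq (signature S c) (crossing S c d)) => [E2 | _] //=.
  - rewrite leqn0 cards_eq0; apply/eqP/setP => A; rewrite !inE -E2 -E1.
    by case: eqP => //=; rewrite andbF.
  - apply: (@leq_trans #|[set crossing S c d]|); last by rewrite cards1.
    apply: subset_leq_card; apply/subsetP => A; rewrite !inE -E1.
    by case: (A == signature S c) => /=; rewrite ?andbF // => /andP[].
  - apply: (@leq_trans #|[set signature S c]|); last by rewrite cards1.
    apply: subset_leq_card; apply/subsetP => A.
    by rewrite !inE -E2 orbb => /andP[].
  - apply: (@leq_trans #|[set signature S c; crossing S c d]|).
      by apply: subset_leq_card; apply/subsetP => A; rewrite inE => /andP[].
    by rewrite cards2; case: (_ != _).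
lia.
Qed.

Lemma card_big_signatures (G : sgraph) (S : {set #|G|.-bseq G}) :
    is_tree G -> path_system S -> 1 < #|S| ->
  #|big_signatures S [set: G]| + 5 <= 3 * #|S|.
Proof.
move=> treeG pathS S2; have [_ acG] := treeG.
have endsT := num_endsT pathS.
have split_ends c u : adj c u -> num_ends S (side c u) + num_ends S (side u c) = 2 * #|S|.
  move=> cu; rewrite (side_compl treeG cu) -setTD -num_ends_setID ?subsetT //.
  by rewrite endsT mulnC.
(* Around such a vertex [t] only its own signature can be big, and [1 + 5 <= 3 * 2]. *)
have few (t : G) : (forall c, adj c t -> num_ends S (side c t) <= 1) ->
    #|big_signatures S [set: G]| + 5 <= 3 * #|S|.
  move=> small; suff : #|big_signatures S [set: G]| <= 1 by lia.
  apply: (@leq_trans #|[set signature S t]|); last by rewrite cards1.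
  apply: subset_leq_card; apply/subsetP => A.
  rewrite !inE => /andP[/imsetP[x _ ->]]; case: (eqVneq x t) => [-> // | xt].
  have [c ct xC] := side_cover treeG xt.
  by rewrite ltnNge (signature_small_branch pathS (side_branch acG ct) (small c ct)).
case: (posnP #|big_signatures S [set: G]|) => [-> | /card_gt0P[A]]; first by lia.
rewrite !inE => /andP[/imsetP[t _ _] _].
pose good (e : G * G) := adj e.1 e.2 && (1 < num_ends S (side e.1 e.2)).
case: (pickP good) => [e0 good0 | none]; last first.
  by apply: (few t) => c ct; have := none (c, t); rewrite /good /= ct ltnNge => /negbFE.
(* Among oriented edges whose side has at least two ends, take one with the smallest side. *)
case: (arg_minnP (fun e => #|side e.1 e.2|) good0) => -[c u] /= /andP[/= cu bigC] minC.
have uc : adj u c by rewrite adj_sym.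
case: (leqP (num_ends S (side u c)) 1) => [smallU | bigU].
  (* A branch at [c] not towards [u] is properly contained in [side c u], so minimality leaves it at
     most one end. *)
  apply: (few c) => d dc; rewrite leqNgt; apply/negP => bigD.
  have du : d != u by apply: contraTneq bigD => ->; rewrite -leqNgt.
  have := minC (d, c); rewrite /good /= dc bigD => /(_ isT); rewrite leqNgt => /negP[].
  apply: proper_card; rewrite properE sub_side //; apply/subsetPn; exists c.
    by have [] := side_branch acG cu.
  by have [] := side_branch acG dc.
have boundC := branch_bound treeG pathS cu bigC.
have boundU := branch_bound treeG pathS uc bigU.
have ends_cu := split_ends c u cu.
set BC := _ :\ _ in boundC; set BU := _ :\ _ in boundU.
(* Adding the two branch bounds gives [2 * m <= 2 + (6 * k - 12)]. *)
have arith w w' e e' k m : 2 * w + 6 <= 3 * e -> 2 * w' + 6 <= 3 * e' ->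
    e + e' = 2 * k -> m <= 1 + (w + w') -> m + 5 <= 3 * k by lia.
apply: (arith _ _ _ _ _ _ boundC boundU ends_cu).
apply: (@leq_trans #|crossing S c u |: (BC :|: BU)|); last first.
  by rewrite cardsU1 leq_add ?leq_b1 ?leq_card_setU.
apply: subset_leq_card; apply/subsetP => B.
rewrite !inE => /andP[/imsetP[x _ Bx] bigB].
rewrite [crossing S u c]setIC -/(crossing S c u) bigB !andbT.
case: eqP => //= _; apply/orP.
case: (boolP (x \in side c u)) => xC; [left | right]; rewrite Bx imset_f //.
by rewrite side_compl // inE.
Qed.

(** Separation makes signatures distinct. With [k] paths, one signature may be empty, [k] are
    singletons at most and [3k - 5] are big at most, for a total of [4k - 4]. *)
Lemma vertex_separating_card (G : sgraph) (S : {set #|G|.-bseq G}) :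
  is_tree G -> vsep_path_system S -> 2 < #|G| -> #|G| + 4 <= 4 * #|S|.
Proof.
move=> treeG /andP[pathS sepS] G3.
have sig_inj : injective (signature S).
  move=> u v sig_uv; apply/eqP; apply: contraT => uv.
  have /exists_inP[P PS] := implyP (forallP (forallP sepS u) v) uv.
  by have /setP/(_ P) := sig_uv; rewrite !inE PS /= => ->; rewrite addbb.
have card_sig : #|G| <= 1 + #|S| + #|big_signatures S [set: G]|.
  apply: (@leq_trans #|signature S @: [set: G]|); first by rewrite card_imset // cardsT.
  have -> : 1 + #|S| = #|(set0 : {set #|G|.-bseq G}) |: [set [set P] | P in S]|.
    rewrite cardsU1 card_imset; last exact: set1_inj.
    suff -> : set0 \notin [set [set P] | P in S] by [].
    by apply/imsetP => -[P _ /setP/(_ P)]; rewrite !inE eqxx.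
  apply: leq_trans (leq_card_setU _ _); apply: subset_leq_card; apply/subsetP => A.
  rewrite !inE => AT; rewrite AT /=; case: (ltngtP #|A| 1) => [| // | /eqP].
  - by rewrite ltnS leqn0 cards_eq0 => ->.
  - by rewrite orbT.
  move/cards1P => [P AP]; rewrite AP; move: AT => /imsetP[x _ Ax].
  have : P \in signature S x by rewrite -Ax AP set11.
  by rewrite inE => /andP[PS _]; rewrite (imset_f set1 PS) orbT.
(* Without big signatures, [#|G| <= 1 + #|S|] and [2 < #|G|] force [#|S|] to be at least 2, which
   suffices. *)
case: (posnP #|big_signatures S [set: G]|) => [big0 | /card_gt0P[A]]; first by lia.
rewrite !inE => /andP[/imsetP[x _ ->] sig2].
have S2 : 1 < #|S|.
  by apply: leq_trans sig2 _; apply: subset_leq_card; apply/subsetP => P; rewrite inE => /andP[].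
have := card_big_signatures treeG pathS S2; lia.
Qed.

(** * Combs *)

Definition parent_adj (par : nat -> nat) (n : nat) : rel 'I_n :=
  fun x y => ((0 < x) && (par x == y)) || ((0 < y) && (par y == x)).
Arguments parent_adj : clear implicits.

Lemma parent_adj_sym par n : symmetric (parent_adj par n).
Proof. by move=> x y; rewrite /parent_adj orbC. Qed.

Lemma parent_adj_irrefl par n :
  (forall j, 0 < j -> par j < j) -> irreflexive (parent_adj par n).
Proof.
move=> par_lt x; rewrite /parent_adj orbb; apply/negP => /andP[/par_lt lt_x /eqP eq_x].
by rewrite eq_x ltnn in lt_x.
Qed.

Definition parent_graph (par : nat -> nat) (par_lt : forall j, 0 < j -> par j < j)
    (n : nat) : sgraph :=
  SGraph (@parent_adj_sym par n) (parent_adj_irrefl par_lt (n := n)).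

(** Descending through parents connects every vertex to 0. On a cycle, both neighbours of the
    largest vertex would have to be its parent. *)
Lemma parent_graph_tree par (par_lt : forall j, 0 < j -> par j < j) n :
  is_tree (parent_graph par_lt n.+1).
Proof.
set G := parent_graph _ _; split.
  have to0 (x : G) : connect (@adj G) x (ord0 : 'I_n.+1).
    have [k] := ubnP (x : 'I_n.+1); elim: k x => // k IH x le_k.
    case: (posnP (x : 'I_n.+1)) => [x0 | x_gt0].
      by have -> : x = ord0 :> 'I_n.+1 by apply: val_inj.
    have lt_x := par_lt _ x_gt0.
    have lt_n : par (x : 'I_n.+1) < n.+1 by apply: ltn_trans lt_x (ltn_ord _).
    apply: (@connect_trans _ _ (Ordinal lt_n : 'I_n.+1)); last first.
      by apply: IH; apply: leq_trans lt_x _.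
    by apply: connect1; rewrite /= /parent_adj x_gt0 /= eqxx.
  move=> x y; apply: connect_trans (to0 x) _.
  by rewrite (sym_connect_sym (@adj_sym G)).
move=> c size_c uniq_c; apply/negP => cycle_c.
have [z0 z0c] : exists z : 'I_n.+1, z \in c.
  by case: c size_c {uniq_c cycle_c} => // z c _; exists z; rewrite mem_head.
case: (arg_maxnP (fun z : 'I_n.+1 => z) z0c) => z zc max_z.
have [i q rot_c] := rot_to zc.
have sub_q a : a \in z :: q -> (a : 'I_n.+1) <= (z : 'I_n.+1).
  by rewrite -rot_c mem_rot => /max_z.
have parent_z a : a \in z :: q -> @adj G z a -> par z = (a : 'I_n.+1).
  move=> /sub_q le_az /orP[/andP[_ /eqP //] | /andP[a_gt0 /eqP par_a]].
  by have := par_lt _ a_gt0; rewrite par_a ltnNge le_az.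
move: cycle_c uniq_c size_c; rewrite -(rot_cycle i) -(rot_uniq i) -(size_rot i) rot_c.
case: q rot_c sub_q parent_z => [|a [|b q]] // _ _ parent_z cycle_z uniq_z _.
move: cycle_z; rewrite /cycle rcons_path => /andP[/andP[za _] lz].
have par_a : par z = (a : 'I_n.+1) by apply: parent_z za; rewrite !inE eqxx orbT.
have par_l : par z = (last b q : 'I_n.+1).
  by apply: parent_z; [rewrite 2!in_cons mem_last !orbT | rewrite adj_sym].
have al : a = last b q by apply: val_inj; rewrite /= -par_a -par_l.
by move: uniq_z; rewrite /= al mem_last /= andbF.
Qed.

(* In column [a] of the comb, [4a], [4a+1], [4a+2] and [4a+3] are the spine
   vertex, the spine vertex subdividing the edge to the next column, the tooth
   and the leaf at its end. *)
Definition comb_parent (j : nat) : nat := j - nth 0 [:: 3; 1; 2; 1] (j %% 4).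

Lemma comb_parent_lt (j : nat) : 0 < j -> comb_parent j < j.
Proof.
rewrite /comb_parent => j_gt0.
have : j %% 4 < 4 by rewrite ltn_mod.
case E: (j %% 4) => [|[|[|[|?]]]] //= _; lia.
Qed.

Definition comb (m : nat) : sgraph := parent_graph comb_parent_lt (4 * m).+4.

Lemma card_comb (m : nat) : #|comb m| = (4 * m).+4.
Proof. exact: card_ord. Qed.

(** * Separating paths in the comb *)

Definition comb_path_nat (i : nat) : seq nat :=
  map (addn (4 * i)) [:: 3; 2; 0; 1; 4; 5; 8; 10].

(** The columns are numbered 0 to [m]. A path that would run past the last one is replaced by the
    single vertex 0, so every index yields a path. *)
Definition comb_path (m i : nat) : seq (comb m) :=
  map (inord : nat -> 'I_(4 * m).+4) (if i + 2 <= m then comb_path_nat i else [:: 0]).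

Lemma comb_path_is_path (m i : nat) : is_path (comb_path m i).
Proof.
rewrite /comb_path; case: leqP => //= le_im.
rewrite !inE /= /parent_adj /comb_parent -!(inj_eq val_inj) /= !inordK; try lia.
rewrite ?[4 * i]mulnC !modnMDl /=.
lia.
Qed.

Lemma mem_comb_path (m i : nat) (x : 'I_(4 * m).+4) :
  i + 2 <= m -> (x \in comb_path m i) = ((x : nat) \in comb_path_nat i).
Proof.
move=> le_im; rewrite /comb_path le_im -(mem_map val_inj) -map_comp.
rewrite -[in RHS](map_id (comb_path_nat i)); congr (_ \in _); apply/eq_in_map => j.
rewrite /comb_path_nat !inE /= => j_in; rewrite inordK //; lia.
Qed.

(** The first two and last two columns. For a column [a] outside them, the paths with indices
    [a - 2], [a - 1] and [a] all fit in the comb. *)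
Definition boundary (m : nat) (x : 'I_(4 * m).+4) : bool := (x < 8) || (4 * m <= x + 4).

(** Indices below 8 enumerate the first two columns and the other eight the last two; for small [m]
    repetitions are harmless. *)
Definition boundary_vertex (m i : nat) : 'I_(4 * m).+4 :=
  inord (if i < 8 then i else 4 * m + i - 12).

Lemma boundary_vertexP (m : nat) (x : 'I_(4 * m).+4) :
  boundary x -> exists i : 'I_16, x = boundary_vertex m i.
Proof.
rewrite /boundary => bx; have x_lt := ltn_ord x.
have i_lt : (if x < 8 then x : nat else x + 12 - 4 * m) < 16 by case: (ltnP x 8) bx; lia.
exists (Ordinal i_lt); rewrite /boundary_vertex /=.
rewrite [X in inord X](_ : _ = x :> nat) ?inord_val //.
by case: (ltnP x 8) bx => /= ? ?; [case: ltnP | case: (ltnP _ 8)]; lia.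
Qed.

Definition comb_system (m : nat) : {set #|comb m|.-bseq (comb m)} :=
  [set insub_bseq #|comb m| (comb_path m i) | i : 'I_m.+1] :|:
  [set insub_bseq #|comb m| [:: boundary_vertex m i : comb m] | i : 'I_16].

Lemma insub_bseqE (G : sgraph) (s : seq G) :
  is_path s -> insub_bseq #|G| s = s :> seq G.
Proof. by move=> /path_size le_s; rewrite /insub_bseq insubdK. Qed.

Lemma comb_system_vsep (m : nat) : vsep_path_system (comb_system m).
Proof.
have path1 (x : comb m) : is_path [:: x] by [].
apply/andP; split.
  apply/forall_inP => P /setUP[/imsetP[i _ ->] | /imsetP[x _ ->]].
    by rewrite insub_bseqE ?comb_path_is_path.
  by rewrite insub_bseqE.
have sep_boundary (u v : comb m) : u != v -> boundary u ->
    [exists P in comb_system m, (u \in (P : seq _)) (+) (v \in (P : seq _))].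
  move=> uv bu; apply/exists_inP; exists (insub_bseq #|comb m| [:: u]).
    have [i ->] := boundary_vertexP bu.
    by apply/setUP; right; apply/imsetP; exists i.
  by rewrite insub_bseqE // !inE eqxx eq_sym (negPf uv).
have sep_path (u v : 'I_(4 * m).+4) i : i + 2 <= m ->
    ((u : nat) \in comb_path_nat i) != ((v : nat) \in comb_path_nat i) ->
    [exists P in comb_system m, ((u : comb m) \in (P : seq _)) (+) ((v : comb m) \in (P : seq _))].
  move=> le_im sep; apply/exists_inP; exists (insub_bseq #|comb m| (comb_path m i)).
    have lt_im : i < m.+1 by lia.
    by apply/setUP; left; apply/imsetP; exists (Ordinal lt_im).
  rewrite insub_bseqE ?comb_path_is_path // !mem_comb_path //.
  by move: sep; case: (_ \in _); case: (_ \in _).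
apply/forallP => u; apply/forallP => v; apply/implyP => uv.
case: (boolP (boundary u)) => [/(sep_boundary _ _ uv) // | int_u].
case: (boolP (boundary v)) => [bv | int_v].
  rewrite eq_sym in uv; have /exists_inP[P PS sepP] := sep_boundary _ _ uv bv.
  by apply/exists_inP; exists P; rewrite // addbC.
move: uv; rewrite -(inj_eq val_inj) /= => uv.
have au := divn_eq (u : 'I__) 4; have av := divn_eq (v : 'I__) 4.
have su : (u : 'I__) %% 4 < 4 by rewrite ltn_mod.
have sv : (v : 'I__) %% 4 < 4 by rewrite ltn_mod.
move: int_u int_v uv; rewrite /boundary => int_u int_v uv.
set a := (u : 'I__) %/ 4 in au; set b := (v : 'I__) %/ 4 in av.
set s := _ %% 4 in au su; set t := _ %% 4 in av sv.
(* Path [i] contains all of column [i], the residues 0 and 1 of column [i + 1], and the residues 0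
   and 2 of column [i + 2]. *)
have mem j c r : j = c * 4 + r -> r < 4 -> forall i, (j \in comb_path_nat i) =
    [|| c == i, (c == i + 1) && (r < 2) | (c == i + 2) && ((r == 0) || (r == 2))].
  by move=> -> r4 i; rewrite /comb_path_nat !inE /=; lia.
(* For different columns, the path starting in the later one misses the earlier one. *)
case: (ltngtP a b) => ab.
- by apply: (sep_path _ _ b); [lia | rewrite (mem _ _ _ au su) (mem _ _ _ av sv); lia].
- by apply: (sep_path _ _ a); [lia | rewrite (mem _ _ _ au su) (mem _ _ _ av sv); lia].
(* In a common column, path [a - 1] separates the residues 0, 1 from 2, 3; path [a - 2] separates
   the even residues from the odd ones, hence within each pair. *)
case: (boolP ((s < 2) == (t < 2))) => st.
- by apply: (sep_path _ _ (a - 2)); [lia | rewrite (mem _ _ _ au su) (mem _ _ _ av sv); lia].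
- by apply: (sep_path _ _ (a - 1)); [lia | rewrite (mem _ _ _ au su) (mem _ _ _ av sv); lia].
Qed.

Lemma fsep_comb (m : nat) : fsep (comb m) <= m + 17.
Proof.
apply: leq_trans (fsep_min (comb_system_vsep m)) _.
apply: leq_trans (leq_card_setU _ _) _.
rewrite -[m + 17]/(m + (1 + 16)) addnA addn1.
by apply: leq_add; apply: leq_trans (leq_imset_card _ _) _; rewrite card_ord.
Qed.

(** * Both bounds over the rationals *)

Lemma isomorphic_card (G H : sgraph) : isomorphic G H -> #|G| = #|H|.
Proof. by case=> h /bij_eq_card. Qed.

Local Open Scope ring_scope.

Theorem theorem6 :
  (forall T : sgraph, is_tree T -> (4 <= #|T|)%N ->
     #|T|%:R / 4%:R + 1 <= (fsep T)%:R :> rat)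
  /\
  (exists (C : rat) (T : nat -> sgraph),
     (forall i j : nat, i <> j -> ~ isomorphic (T i) (T j)) /\
     (forall i : nat,
        [/\ is_tree (T i), (4 <= #|T i|)%N &
            (fsep (T i))%:R <= #|T i|%:R / 4%:R + C :> rat])).
Proof.
split=> [T treeT T4 | ].
  have [S sepS ->] := fsep_attained T.
  have := vertex_separating_card treeT sepS (ltnW T4).
  by rewrite -(ler_nat rat) natrD natrM; lra.
(* A comb has [4 * (m + 1)] vertices, so [m + 17] is a quarter of their number plus 16; different
   vertex counts exclude isomorphisms. *)
exists 16%:R, comb; split=> [i j ij /isomorphic_card | i].
  by rewrite !card_comb => ?; apply: ij; lia.
split; [exact: parent_graph_tree | by rewrite card_comb | ].
have := fsep_comb i; rewrite card_comb -(ler_nat rat).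
rewrite -[((4 * i).+4)%N]addn4 (natrD _ (4 * i)%N) natrM natrD.
lra.
Qed.
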